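(* Let $\{f_n\}_{n\ge1}$ be a sequence of Boolean functions $f_n:\{0,1\}^{m_n}\to\{0,1\}$ and $\{p_n\}$ be a sequence in $[0,1]$. Then for each $n$, $\mathbb{E}[C_n]=\sum_{i}\mathbf{I}^{p_n}_i(f_n)$. Consequently, if $\sup_n\sum_i\mathbf{I}^{p_n}_i(f_n)<\infty$, then $\{f_n\}_{n\ge1}$ is tame with respect to $\{p_n\}$.
   Context: For each $n$, $X^{(n)}(t)=(X^{(n)}_1(t),\dots,X^{(n)}_{m_n}(t))$, $t\ge0$, where the coordinates are independent stationary continuous-time Markov chains on $\{0,1\}$ jumping from $0$ to $1$ at rate $p_n$ and from $1$ to $0$ at rate $1-p_n$ (so each is $1$ with probability $p_n$ at any fixed time). $C_n$ is the number of times $f_n(X^{(n)}(t))$ changes state during $[0,1]$. The sequence is tame with respect to $\{p_n\}$ if $\{C_n\}_{n\ge1}$ is tight. Influence: for a Boolean function $f$ on $\{0,1\}^m$ and $p\in[0,1]$, let $\omega$ be distributed according to the product measure $\mathbb{P}_p$ with each coordinate equal to $1$ with probability $p$, and let $\omega^i$ be $\omega$ with bit $i$ rerandomized to be $1$ with probability $p$ and $0$ with probability $1-p$ (independently). The influence of bit $i$ on $f$ at parameter $p$ is $\mathbf{I}^p_i(f)=\mathbb{P}_p(f(\omega)\ne f(\omega^i))$. The sum in the claim is over $i\in\{1,\dots,m_n\}$. *)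

(* Defs.v *)
From HB Require Import structures.
From mathcomp Require Import all_boot all_order all_algebra.
From mathcomp Require Import all_classical all_reals all_analysis.

Set Implicit Arguments.
Unset Strict Implicit.
Unset Printing Implicit Defensive.

Import Order.TTheory GRing.Theory Num.Theory.
Import numFieldNormedType.Exports.
Local Open Scope classical_set_scope.
Local Open Scope ring_scope.

Section influence.
Variables (R : realType) (m : nat) (p : R).
Implicit Types (f : {ffun 'I_m -> bool} -> bool) (x : {ffun 'I_m -> bool}).

Definition cube_pmf x : R := \prod_(i < m) bernoulli_pmf p (x i).

Definition set_bit x (i : 'I_m) (b : bool) : {ffun 'I_m -> bool} :=
  [ffun j => if j == i then b else x j].

(* The probability that f x != f (set_bit x i b), where x has law cube_pmf and
   b is an independent Bernoulli(p) bit. *)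
Definition influence f (i : 'I_m) : R :=
  \sum_x \sum_(b : bool)
    if f x != f (set_bit x i b) then cube_pmf x * bernoulli_pmf p b else 0.

End influence.

(* Generator (Q-matrix) with rate p from 0 to 1 and rate 1 - p from 1 to 0. *)
Definition flip_rate (R : realType) (p : R) (a b : bool) : R :=
  match a, b with
  | false, true => p
  | false, false => - p
  | true, false => 1 - p
  | true, true => - (1 - p)
  end.

Record is_markov_semigroup (R : realType) (q : bool -> bool -> R)
    (tr : R -> bool -> bool -> R) : Prop := {
  tr_ge0 : forall t a b, 0 <= t -> 0 <= tr t a b ;
  tr_sum1 : forall t a, 0 <= t -> \sum_(b : bool) tr t a b = 1 ;
  tr_0 : forall a b, tr 0 a b = (a == b)%:R ;
  tr_add : forall s t a b, 0 <= s -> 0 <= t ->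
    tr (s + t) a b = \sum_(c : bool) tr s a c * tr t c b ;
  tr_rate : forall a b,
    (tr h a b - (a == b)%:R) / h @[h --> 0^'+] --> q a b }.

(* Processes are indexed by R, but only times t >= 0 are meaningful. *)
Section process.
Context d (T : measurableType d) (R : realType) (P : probability T R).
Implicit Types (Y : R -> T -> bool).

Definition process_sigma Y (D : set R) : set (set T) :=
  <<s [set A | exists t b, D t /\ A = Y t @^-1` [set b]] >>.

Definition cadlag (g : R -> bool) : Prop :=
  (forall t, 0 <= t -> \forall s \near t^'+, g s = g t) /\
  (forall t, 0 < t -> exists b, \forall s \near t^'-, g s = b).

Definition markov_with (q : bool -> bool -> R) Y : Prop :=
  exists2 tr, is_markov_semigroup q tr &
  forall (s t : R) (a b : bool) (A : set T), 0 <= s -> 0 <= t ->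
    process_sigma Y `[0, s] A ->
    P (A `&` [set w | Y s w = a] `&` [set w | Y (s + t) w = b]) =
    (P (A `&` [set w | Y s w = a]) * (tr t a b)%:E)%E.

Definition stationary Y : Prop :=
  forall (k : nat) (t : 'I_k -> R) (a : 'I_k -> bool) (s : R),
    (forall j, 0 <= t j) -> 0 <= s ->
    P [set w | forall j, Y (t j + s) w = a j] =
    P [set w | forall j, Y (t j) w = a j].

Record stationary_flip_chain (p : R) Y : Prop := {
  flip_measurable : forall t, 0 <= t -> measurable_fun setT (Y t) ;
  flip_cadlag : forall w, cadlag (fun t => Y t w) ;
  flip_markov : markov_with (flip_rate p) Y ;
  flip_stationary : stationary Y }.

Definition independent_processes (m : nat) (X : 'I_m -> R -> T -> bool) : Prop :=
  forall A : 'I_m -> set T,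
    (forall i, process_sigma (X i) `[0, +oo[ (A i)) ->
    P (\bigcap_i A i) = (\prod_(i < m) P (A i))%E.

Definition dynamics (m : nat) (p : R) (X : 'I_m -> R -> T -> bool) : Prop :=
  (forall i, stationary_flip_chain p (X i)) /\ independent_processes X.

(* Times in [0, 1] at which g differs from its left limit; time 0 never
   counts, since g has no past there. *)
Definition change_times (g : R -> bool) : set R :=
  [set t | 0 < t <= 1 /\ \forall s \near t^'-, g s != g t].

Definition nb_changes (m : nat) (f : {ffun 'I_m -> bool} -> bool)
    (X : 'I_m -> R -> T -> bool) (w : T) : \bar R :=
  counting (change_times (fun t => f [ffun i => X i t w])).

End process.

Definition tight (R : realType) (d : nat -> measure_display)
    (T : forall n, measurableType (d n)) (P : forall n, probability (T n) R)
    (C : forall n, T n -> \bar R) : Prop :=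
  forall e : R, 0 < e -> exists K : R, forall n,
    (P n [set w | (K%:E < `|C n w|)%E] <= e%:E)%E.

(* To be used when X n is a realization of the dynamics with parameter p_n: the
   sequence p enters only through the law of X n. *)
Definition tame (R : realType) (d : nat -> measure_display)
    (T : forall n, measurableType (d n)) (P : forall n, probability (T n) R)
    (m : nat -> nat) (f : forall n, {ffun 'I_(m n) -> bool} -> bool)
    (X : forall n, 'I_(m n) -> R -> T n -> bool) : Prop :=
  tight P (fun n => nb_changes (f n) (X n)).

(* Main.v *)
Require Import Defs.
From HB Require Import structures.
From mathcomp Require Import all_boot all_order all_algebra.
From mathcomp Require Import all_classical all_reals all_analysis.
From mathcomp Require Import measurable_realfun lra.

Set Implicit Arguments.
Unset Strict Implicit.
Unset Printing Implicit Defensive.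

Import Order.TTheory GRing.Theory Num.Theory.
Import numFieldNormedType.Exports.
Local Open Scope classical_set_scope.
Local Open Scope ring_scope.

(** Right-continuity alone makes the number of changes of [f (X t)] seen on the
grid of mesh [1 / N] at most the number [C] of change times, and convergent to
[C] as [N] grows; Fatou's lemma then gives [E C] as the limit of the expected
number of changes on the grid.  The law of each chain at a fixed time is
Bernoulli(p), so by the Markov property and independence this expectation is
[N] times the probability that [f (X 0) != f (X (1 / N))].  At first order in
[1 / N] at most one coordinate jumps, to the value [b] at rate
[bernoulli_pmf p b], which is how rerandomization acts on one bit; the limit is
the sum of the influences.  Tightness is Markov's inequality. *)

(** * Paths: grid counts against the number of change times *)

Section paths.
Context {R : realType}.
Implicit Types (g : R -> bool) (t : R).

Definition right_locally_constant g :=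
  forall t, 0 <= t -> \forall s \near t^'+, g s = g t.

(** The mesh is [1 / n.+1], so every [n], including [0], gives a genuine subdivision of [[0, 1]]. *)
Definition grid_changes g (n : nat) : nat :=
  #|[set k : 'I_n.+1 | g (k%:R / n.+1%:R) != g (k.+1%:R / n.+1%:R)]%SET|.

(** Lower bounds by duplicate-free lists treat finite sets and infinite ones, where [counting] is
    [+oo], alike. *)
Lemma size_le_counting (T : choiceType) (A : set T) (s : seq T) :
  uniq s -> (forall x, x \in s -> A x) -> ((size s)%:R%:E <= counting A :> \bar R)%E.
Proof.
move=> us sA; rewrite /counting; case: asboolP => [fA|_]; last exact: leey.
rewrite lee_fin ler_nat; apply: uniq_leq_size => // x /sA Ax.
by rewrite in_fset_set// inE.
Qed.

Lemma near_all_seq (I : Type) (T : eqType) (F : set_system I) (s : seq T)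
    (Q : T -> I -> Prop) : Filter F ->
  (forall x, x \in s -> \forall i \near F, Q x i) ->
  \forall i \near F, forall x, x \in s -> Q x i.
Proof.
move=> FF; elim: s => [_|t s IH sQ]; first by near=> i.
have Qt : \forall i \near F, Q t i by apply: sQ; rewrite mem_head.
have Qs : \forall i \near F, forall u, u \in s -> Q u i.
  by apply: IH => u us; apply: sQ; rewrite in_cons us orbT.
near=> i => u; rewrite in_cons => /orP[/eqP ->|]; first by near: i.
by move: u; near: i.
Unshelve. all: by end_near. Qed.

(** The change time is the supremum [t] of the times up to which [g] keeps the value [g a]: the
    value persists before [t] and is lost at [t] itself. *)
Lemma change_time_between g (a b : R) : right_locally_constant g ->
  0 <= a -> a < b -> g a != g b ->
  exists2 t, a < t <= b & \forall s \near t^'-, g s != g t.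
Proof.
move=> rg a0 ab gab.
pose E := [set t | a <= t <= b /\ forall s, a <= s <= t -> g s = g a].
have Ea : E a.
  split; first by rewrite lexx ltW.
  by move=> s /andP[? ?]; congr g; apply/eqP; rewrite eq_le; apply/andP.
have ubE : ubound E b by move=> t [/andP[]].
have hE : has_sup E by split; [exists a|exists b].
pose t := sup E.
have at_ : a <= t by apply: ub_le_sup => //; exists b.
have tb : t <= b by apply: ge_sup => //; exists a.
have before s : a <= s < t -> g s = g a.
  move=> /andP[as_ st]; have [u [_ Eu] su] := sup_gt (ex_intro _ a Ea) st.
  by apply: Eu; rewrite as_ ltW.
have gt : g t != g a.
  (* Otherwise right-continuity at [t] would prolong the constancy to some [u > t], against the
     supremum. Taking [e / 2] keeps [u] inside the neighbourhood, and the minimum keeps it below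
     [b]. *)
  apply/negP => /eqP gta.
  have {}tb : t < b.
    by rewrite lt_neqAle tb andbT; apply: contra gab => /eqP <-; rewrite gta.
  have [e /= e0 He] := rg _ (le_trans a0 at_).
  pose u := Num.min b (t + e / 2).
  have tu : t < u by rewrite lt_min tb ltrDl divr_gt0.
  suff : E u by move=> /(ub_le_sup (ex_intro _ b ubE)); rewrite leNgt tu.
  split; first by rewrite (le_trans at_ (ltW tu)) ge_min lexx.
  move=> s /andP[as_ su]; have [st|ts|->//] := ltgtP s t.
    by apply: before; rewrite as_.
  rewrite -gta; apply: He => //=; rewrite ltr0_norm ?subr_lt0// opprB.
  rewrite ltrBlDl (le_lt_trans su)//.
  by rewrite gt_min ltrD2l ltr_pdivrMr// ltr_pMr// ltr1n orbT.
have lat : a < t.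
  by rewrite lt_neqAle at_ andbT; apply: contra gt => /eqP <-.
exists t; first by rewrite lat.
near=> s; rewrite before 1?eq_sym//; apply/andP; split.
  by near: s; apply: nbhs_left_ge.
by near: s; apply: nbhs_left_lt.
Unshelve. all: by end_near. Qed.

(** Each cell whose ends disagree contains a change time, and the cells, open on the left and closed
    on the right, are disjoint, so these times are distinct. *)
Lemma grid_changes_le g n : right_locally_constant g ->
  ((grid_changes g n)%:R%:E <= counting (change_times g) :> \bar R)%E.
Proof.
move=> rg; pose I := [set k : 'I_n.+1 | g (k%:R / n.+1%:R) != g (k.+1%:R / n.+1%:R)]%SET.
have N0 : 0 < n.+1%:R :> R by rewrite ltr0n.
(* Choice needs a total function; cells without a visible change get the dummy time [0]. *)
have /choice[c Hc] : forall k : 'I_n.+1, exists t, k \in I ->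
    k%:R / n.+1%:R < t <= k.+1%:R / n.+1%:R /\ \forall s \near t^'-, g s != g t.
  move=> k; case: (boolP (k \in I)) => [|_]; last by exists 0.
  rewrite inE => gk; have [||t ? ?] := change_time_between rg _ _ gk.
  - by rewrite divr_ge0// ler0n.
  - by rewrite ltr_pM2r ?invr_gt0// ltr_nat.
  by exists t.
have cI k l : k \in I -> l \in I -> (k < l)%N -> c k < c l.
  move=> /Hc[/andP[_ k1] _] /Hc[/andP[l1 _] _] kl; apply: le_lt_trans k1 _.
  by apply: le_lt_trans l1; rewrite ler_pM2r ?invr_gt0// ler_nat.
rewrite /grid_changes -/I cardE -(size_map c); apply: size_le_counting.
  rewrite map_inj_in_uniq ?enum_uniq// => k l.
  rewrite !mem_enum => kI lI ckl; apply: val_inj => /=.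
  by have [/(cI _ _ kI lI)|/(cI _ _ lI kI)|//] := ltngtP k l; rewrite ckl ltxx.
move=> _ /mapP[k + ->]; rewrite mem_enum => /Hc[/andP[k1 k2] k3].
split=> //; rewrite (le_lt_trans _ k1) ?divr_ge0 ?ler0n//= (le_trans k2)//.
by rewrite ler_pdivrMr// mul1r ler_nat.
Qed.

(** Only two values exist, so differing from [g t] just before [t] means being [~~ g t] there;
    right-continuity settles the other side. *)
Lemma change_times_isolated g t : right_locally_constant g -> change_times g t ->
  \forall n \near \oo, forall a, `|a - t| <= n.+1%:R^-1 ->
    g a = (if t <= a then g t else ~~ g t).
Proof.
move=> rg [/andP[t0 _] [e /= e0 He]].
have [e' /= e'0 He'] := rg _ (ltW t0).
have m0 : 0 < Num.min e e' by rewrite lt_min e0.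
near=> n => a an.
have {}an : `|t - a| < Num.min e e'.
  rewrite distrC; apply: le_lt_trans an _; near: n.
  exact: (near_infty_natSinv_lt (PosNum m0)).
move: an; rewrite lt_min => /andP[a1 a2].
case: ltgtP => [ta|at_|->//]; first exact: He'.
by have := He _ a1 at_; case: (g a) (g t) => [] [].
Unshelve. all: by end_near. Qed.

(** Once the mesh is below the isolation radius of every time in [s], the cell around each of them
    has ends with opposite values, and no two of them share a cell. *)
Lemma grid_changes_ge g (s : seq R) : right_locally_constant g -> uniq s ->
  (forall t, t \in s -> change_times g t) ->
  \forall n \near \oo, (size s <= grid_changes g n)%N.
Proof.
move=> rg us sg.
have := near_all_seq _ (fun t ts => change_times_isolated rg (sg t ts)).
move=> /(_ _); apply: filterS => n Hn.
have N0 : 0 < n.+1%:R :> R by rewrite ltr0n.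
have /choice[c Hc] : forall t, exists k : 'I_n.+1, t \in s ->
    k%:R / n.+1%:R < t <= k.+1%:R / n.+1%:R.
  move=> t; case: (boolP (t \in s)) => [ts|_]; last by exists ord0.
  have [/andP[t0 t1] _] := sg _ ts.
  (* The cell of [t] has index one less than the ceiling of [t * n.+1%:R], a natural number because
     [t > 0]. *)
  have := ceil_itv (t * n.+1%:R); set z := Num.ceil _ => /andP[z1 z2].
  have z0 : 0 < z by rewrite -(ltr0z R); apply: lt_le_trans z2; rewrite mulr_gt0.
  case: z z0 z1 z2 => // -[//|k] _ z1 z2.
  have kn : (k < n.+1)%N.
    rewrite -(ltr_nat R); apply: lt_le_trans (_ : t * n.+1%:R <= _).
      by rewrite (le_lt_trans _ z1)// -addn1 PoszD addrK.
    by rewrite ger_pMl.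
  exists (Ordinal kn) => _ /=; rewrite ltr_pdivrMr// ler_pdivlMr//.
  by rewrite z2 andbT (le_lt_trans _ z1)// -addn1 PoszD addrK.
have Ni0 : 0 < n.+1%:R^-1 :> R by rewrite invr_gt0.
(* The boolean selects the left ([false]) or right ([true]) end of the cell. *)
have close t (i : bool) : t \in s -> `|(c t + i)%:R / n.+1%:R - t| <= n.+1%:R^-1.
  move=> /Hc/andP[]; rewrite -(addn1 (c t)) natrD mulrDl mul1r => h1 h2.
  rewrite natrD mulrDl; move: Ni0 h1 h2; move: (_^-1) => e.
  move: (_ * e) => q e0 h1 h2.
  by rewrite ler_norml; case: i; rewrite /= ?mul1r ?mul0r ?addr0; apply/andP; split; lra.
have gl t : t \in s -> g ((c t)%:R / n.+1%:R) = ~~ g t.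
  move=> ts; have := Hn _ ts _ (close t false ts); rewrite addn0 => ->.
  by have /andP[+ _] := Hc _ ts; rewrite ltNge => /negPf ->.
have gr t : t \in s -> g ((c t).+1%:R / n.+1%:R) = g t.
  move=> ts; have := Hn _ ts _ (close t true ts); rewrite addn1 => ->.
  by have /andP[_ ->] := Hc _ ts.
(* In a shared cell the common left end forces [g t = g u], while [t], just before the change at
   [u], must have the value [~~ g u]. *)
have injc : {in s &, forall t u, t < u -> c t <> c u}.
  move=> t u ts us' tu ctu.
  have /andP[h1 h2] := Hc _ ts; have /andP[h3 h4] := Hc _ us'.
  have := gl _ us'; rewrite -ctu gl// => /negb_inj gtu.
  have := Hn _ us' t; rewrite (leNgt u t) tu gtu => H.
  suff /H : `|t - u| <= n.+1%:R^-1 by case: (g u).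
  move: h4; rewrite -ctu -(addn1 (c t)) natrD mulrDl mul1r => h4.
  move: Ni0 h1 h4; move: (_^-1) => e; move: (_ * e) => q e0 h1 h4.
  by rewrite ler_norml; apply/andP; split; lra.
rewrite /grid_changes -(size_map c) cardE; apply: uniq_leq_size.
  rewrite map_inj_in_uniq// => t u ts us' ctu.
  by have [/(injc _ _ ts us')|/(injc _ _ us' ts)|//] := ltgtP t u; rewrite ctu.
by move=> _ /mapP[t ts ->]; rewrite mem_enum inE gl// gr//; case: (g t).
Qed.

(** With finitely many change times the two bounds make the grid count eventually constant; with
    infinitely many, finite subsets of every size push it to [+oo]. *)
Lemma cvg_grid_changes g : right_locally_constant g ->
  (grid_changes g n)%:R%:E @[n --> \oo] --> (counting (change_times g) : \bar R).
Proof.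
move=> rg; have [fA|iA] := pselect (finite_set (change_times g)); last first.
  rewrite {1}/counting asboolF//; apply/cvgenyP/cvgnyPge => k.
  have [B BA kB] := infinite_set_fset k iA.
  have := grid_changes_ge rg (finmap.fset_uniq B) (fun t tB => BA t tB).
  by apply: filterS => n; apply: leq_trans.
set l := counting _; have lE : l = (size (finmap.enum_fset (fset_set (change_times g))))%:R%:E.
  by rewrite /l /counting asboolT.
apply: cvg_near_cst.
have sub t : t \in finmap.enum_fset (fset_set (change_times g)) -> change_times g t.
  by rewrite in_fset_set// inE.
have := grid_changes_ge rg (finmap.fset_uniq _) sub.
apply: filterS => n hn; apply/eqP; rewrite eq_le.
by rewrite grid_changes_le//= -/l lE lee_fin ler_nat hn.
Qed.

End paths.

(** * First-order asymptotics of the transition probabilities *)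

Section short_time.
Context {R : realType} (m : nat) (p : R).
Implicit Types (x y : {ffun 'I_m -> bool}).

Lemma flip_rateN (a b : bool) : a != b -> flip_rate p a b = bernoulli_pmf p b.
Proof. by case: a b => [] []. Qed.

Lemma cvg_sumr (I : Type) (r : seq I) (Q : pred I) (F : set_system R)
    (u : I -> R -> R) (l : I -> R) : Filter F ->
  (forall i, Q i -> u i h @[h --> F] --> l i) ->
  (\sum_(i <- r | Q i) u i h) @[h --> F] --> \sum_(i <- r | Q i) l i.
Proof. by move=> FF ul; apply: cvg_big => //; exact: add_continuous. Qed.

Lemma cvg_prodr (I : Type) (r : seq I) (Q : pred I) (F : set_system R)
    (u : I -> R -> R) (l : I -> R) : Filter F ->
  (forall i, Q i -> u i h @[h --> F] --> l i) ->
  (\prod_(i <- r | Q i) u i h) @[h --> F] --> \prod_(i <- r | Q i) l i.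
Proof. by move=> FF ul; apply: cvg_big => //; exact: mul_continuous. Qed.

(** Differentiability at [0] gives continuity: multiply the difference quotient by [h] and add back
    the value at [0]. *)
Lemma semigroup_cvg0 q (tr : R -> bool -> bool -> R) a b :
  is_markov_semigroup q tr -> tr h a b @[h --> 0^'+] --> ((a == b)%:R : R).
Proof.
move=> trP; have h0 : h @[h --> (0 : R)^'+] --> (0 : R).
  by apply: cvg_at_right_filter; exact: cvg_id.
have H := cvgD (cvgM (@tr_rate _ _ _ trP a b) h0) (cvg_cst ((a == b)%:R : R)).
rewrite mulr0 add0r in H; apply: (cvg_trans _ (H _ _ _)); apply: near_eq_cvg.
near=> h; rewrite /= /GRing.mul_fun/= fctE/= divfK ?subrK// gt_eqF//.
Unshelve. all: by end_near. Qed.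

Variable tr : 'I_m -> R -> bool -> bool -> R.
Hypothesis trP : forall i, is_markov_semigroup (flip_rate p) (tr i).

(* Only one coordinate jumps at first order in h. *)
Lemma cvg_transition_rate x y : x != y ->
  (\prod_(i < m) tr i h (x i) (y i)) / h @[h --> 0^'+] -->
  \sum_(i < m) \sum_(b : bool)
    (if y == set_bit x i b then bernoulli_pmf p b else 0).
Proof.
move=> xy.
have /existsP[i0 xi0] : [exists i, x i != y i].
  rewrite -negb_forall; apply: contra xy => /forallP xy.
  by apply/eqP/ffunP => i; exact/eqP.
(* As [x] and [y] differ at [i0], only the term [i = i0], [b = y i0] can survive, and it does when
   they agree everywhere else. *)
have limE : \sum_(i < m) \sum_(b : bool)
      (if y == set_bit x i b then bernoulli_pmf p b else 0) =
    bernoulli_pmf p (y i0) * \prod_(i < m | i != i0) (x i == y i)%:R.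
  rewrite (bigD1 i0)//= [X in _ + X]big1 => [|i ii0]; last first.
    apply: big1 => b _; case: eqP => // yE; move: xi0.
    by rewrite yE ffunE [i0 == i]eq_sym (negPf ii0) eqxx.
  rewrite addr0 (bigD1 (y i0))//= big1 => [|b bi0]; last first.
    by case: eqP => // yE; move: bi0; rewrite yE ffunE eqxx eqxx.
  rewrite addr0; case: eqP => [yE|/eqP yN].
    rewrite big1 ?mulr1// => i ii0.
    by rewrite [in X in _ == X]yE ffunE (negPf ii0) eqxx.
  have /existsP[i /andP[ii0 xyi]] : [exists i, (i != i0) && (x i != y i)].
    apply: contraR yN; rewrite negb_exists => /forallP H.
    apply/eqP/ffunP => i; rewrite ffunE; case: eqP => [->//|/eqP ii0].
    by have := H i; rewrite ii0/= negbK => /eqP.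
  by rewrite (bigD1 i)//= (negPf xyi) mul0r mulr0.
rewrite limE -(flip_rateN xi0).
have c1 := @tr_rate _ _ _ (trP i0) (x i0) (y i0).
have c2 : \prod_(i < m | i != i0) tr i h (x i) (y i) @[h --> 0^'+] -->
    \prod_(i < m | i != i0) ((x i == y i)%:R : R).
  by apply: cvg_prodr => i _; exact: semigroup_cvg0.
(* The factor [1 / h] is absorbed by coordinate [i0], whose difference quotient has no diagonal
   term; the other factors tend to indicators. *)
apply: (cvg_trans _ (cvgM c1 c2)); apply: near_eq_cvg; near=> h.
by rewrite /= [RHS](congr1 (fun z => z / h) (bigD1 i0 _))//= (negPf xi0) subr0 mulrAC.
Unshelve. all: by end_near. Qed.

(** The probability that [f] takes different values at two times [h] apart: for each coordinate,
    [bernoulli_pmf p a * tr i h a b] is the joint law of its states at these times. *)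
Definition change_prob (f : {ffun 'I_m -> bool} -> bool) (h : R) : R :=
  \sum_x \sum_(y | f x != f y)
    \prod_(i < m) (bernoulli_pmf p (x i) * tr i h (x i) (y i)).

Lemma cvg_change_prob f :
  change_prob f h / h @[h --> 0^'+] --> \sum_(i < m) influence p f i.
Proof.
(* Sorting rerandomizations by their outcome [y] turns the influences into a sum over the same pairs
   as in [change_prob], so that limits can be taken term by term. *)
have -> : \sum_(i < m) influence p f i =
    \sum_x \sum_(y | f x != f y) cube_pmf p x *
      \sum_(i < m) \sum_(b : bool)
        (if y == set_bit x i b then bernoulli_pmf p b else 0).
  rewrite exchange_big/=; apply: eq_bigr => x _.
  rewrite -mulr_sumr [in RHS]exchange_big/= mulr_sumr; apply: eq_bigr => i _.
  rewrite [in RHS]exchange_big/= mulr_sumr; apply: eq_bigr => b _.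
  case: ifPn => fx; last first.
    rewrite big1 ?mulr0// => y fy; case: eqP => // yE.
    by rewrite yE (negPf fx) in fy.
  by rewrite -big_mkcondr/= (big_pred1 (set_bit x i b))// => y /=;
    case: (y =P _) => [->|_]; rewrite ?fx ?andbF.
have -> : (fun h => change_prob f h / h) = (fun h => \sum_x \sum_(y | f x != f y)
    cube_pmf p x * ((\prod_(i < m) tr i h (x i) (y i)) / h)).
  apply/funext => h; rewrite /change_prob mulr_suml; apply: eq_bigr => x _.
  by rewrite mulr_suml; apply: eq_bigr => y _; rewrite big_split/= mulrA.
apply: cvg_sumr => x _; apply: cvg_sumr => y fxy.
apply: cvgM; first exact: cvg_cst.
by apply: cvg_transition_rate; apply: contra fxy => /eqP ->.
Qed.

End short_time.

(** * Laws of a single stationary chain at one and two times *)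

Section chains.
Context d (T : measurableType d) (R : realType) (P : probability T R).

Lemma measurable_state (p : R) (Y : R -> T -> bool) (t : R) (b : bool) :
  stationary_flip_chain P p Y -> 0 <= t -> measurable [set w | Y t w = b].
Proof.
move=> YP t0; rewrite -[X in measurable X]setTI.
exact: (flip_measurable YP t0 measurableT (_ : measurable [set b])).
Qed.

(** The body of [markov_with] for a fixed [tr], so that the semigroup of each coordinate can be
    named. *)
Definition markov_for (Y : R -> T -> bool) (tr : R -> bool -> bool -> R) :=
  forall (s t : R) (a b : bool) (A : set T), 0 <= s -> 0 <= t ->
    process_sigma Y `[0, s] A ->
    P (A `&` [set w | Y s w = a] `&` [set w | Y (s + t) w = b]) =
    (P (A `&` [set w | Y s w = a]) * (tr t a b)%:E)%E.

Lemma markov_two_times (Y : R -> T -> bool) (tr : R -> bool -> bool -> R) :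
  markov_for Y tr ->
  forall s t a b, 0 <= s -> 0 <= t ->
    P ([set w | Y s w = a] `&` [set w | Y (s + t) w = b]) =
    (P [set w | Y s w = a] * (tr t a b)%:E)%E.
Proof.
move=> mk s t a b s0 t0; have := mk s t a b setT s0 t0.
rewrite !setTI; apply; rewrite -setC0 -setTD.
by apply: sigma_algebraCD; exact: sigma_algebra0.
Qed.

Lemma stationary1 (Y : R -> T -> bool) (s : R) (b : bool) :
  stationary P Y -> 0 <= s -> P [set w | Y s w = b] = P [set w | Y 0 w = b].
Proof.
move=> st s0; have := st 1%N (fun=> 0) (fun=> b) s (fun=> lexx _) s0.
have E (u : R) : [set w | forall j : 'I_1, Y u w = b] = [set w | Y u w = b].
  by apply/seteqP; split => [w /(_ ord0)|w Yw j].
by rewrite !E add0r.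
Qed.

(* Stationarity is detailed balance pi(0) tr(0,1) = pi(1) tr(1,0); dividing by
   the elapsed time gives pi(0) p = pi(1) (1 - p) in the limit. *)
Lemma stationary_law (p : R) (Y : R -> T -> bool) (s : R) (b : bool) :
  stationary_flip_chain P p Y -> 0 <= s ->
  P [set w | Y s w = b] = (bernoulli_pmf p b)%:E.
Proof.
move=> YP s0; have [tr trP mk] := flip_markov YP.
have {mk} mk2 := markov_two_times mk.
have st := stationary1 _ (flip_stationary YP).
rewrite {}st// => {s s0}.
pose pi b := fine (P [set w | Y 0 w = b]).
have piE c : P [set w | Y 0 w = c] = (pi c)%:E.
  by rewrite fineK//; apply: fin_num_measure; apply: measurable_state YP _.
have split_state (A : set T) t : measurable A -> 0 <= t ->
    P A = (P (A `&` [set w | Y t w = true]) + P (A `&` [set w | Y t w = false]))%E.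
  move=> mA t0; rewrite -measureU//.
  - rewrite -setIUr; congr (P _); apply/seteqP; split => w //= => [Aw|[]//].
    by split => //; case: (Y t w); [left|right].
  - by apply: measurableI => //; exact: measurable_state YP t0.
  - by apply: measurableI => //; exact: measurable_state YP t0.
  - by rewrite setIACA setIid -subset0 => w [_ [/= ->]].
have pi1 : pi true + pi false = 1.
  apply: EFin_inj; rewrite EFinD -!piE -(probability_setT P).
  by rewrite (split_state setT 0)// !setTI.
(* The mass of state [true] at time [t], split by the state at time [0], is still [pi true]; cancel
   the part that was in [true] at both times. *)
have balance t : 0 <= t -> pi false * tr t false true = pi true * tr t true false.
  move=> t0; have mk0 a c := mk2 0 t a c (lexx _) t0.
  have := split_state [set w | Y t w = true] 0 (measurable_state true YP t0) (lexx _).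
  rewrite (stationary1 _ (flip_stationary YP))// piE ![[set w | Y t w = true] `&` _]setIC.
  rewrite -[t]add0r !mk0 add0r !piE -!EFinM -EFinD => -[e1].
  have := tr_sum1 trP true t0; rewrite big_bool/= => e2.
  apply: (addrI (pi true * tr t true true)).
  by rewrite -mulrDr e2 mulr1 -e1.
have c1 : pi false * ((tr h false true - (false == true)%:R) / h) @[h --> 0^'+] -->
    pi false * p.
  by apply: cvgM; [exact: cvg_cst|exact: (@tr_rate _ _ _ trP false true)].
have c2 : pi true * ((tr h true false - (true == false)%:R) / h) @[h --> 0^'+] -->
    pi true * (1 - p).
  by apply: cvgM; [exact: cvg_cst|exact: (@tr_rate _ _ _ trP true false)].
have e : pi false * p = pi true * (1 - p).
  apply: (@cvg_unique _ (@norm_hausdorff _ R) _ _ _ _ c1).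
  apply: (cvg_trans _ c2); apply: near_eq_cvg; near=> h.
  by rewrite !subr0 !mulrA balance.
(* Adding [pi true * p] to both sides of [e] and using total mass [1] avoids any division, so
   [p = 0] and [p = 1] are covered. *)
have pip : pi true = p.
  rewrite -[LHS]mulr1 -[X in _ * X](subrK p) mulrDr -e -mulrDl.
  by rewrite [X in X * _]addrC pi1 mul1r.
rewrite piE; case: b => /=; rewrite -?pip//; congr EFin.
by rewrite -pi1 addrC addKr.
Unshelve. all: by end_near. Qed.

End chains.

(** * Expected number of changes for independent chains *)

Section dynamics.
Context d (T : measurableType d) (R : realType) (P : probability T R).
Context (m : nat) (p : R) (X : 'I_m -> R -> T -> bool).
Hypothesis XP : dynamics P p X.
Variable f : {ffun 'I_m -> bool} -> bool.

Local Notation path w := (fun t => f [ffun i => X i t w]).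

Let two_times (s t : R) (x y : {ffun 'I_m -> bool}) (i : 'I_m) : set T :=
  [set w | X i s w = x i] `&` [set w | X i t w = y i].

Lemma measurable_two_times s t x y : 0 <= s -> 0 <= t ->
  measurable (\bigcap_i two_times s t x y i).
Proof.
move=> s0 t0; apply: fin_bigcap_measurable => // i _.
by apply: measurableI; apply: measurable_state (XP.1 i) _.
Qed.

(** Finitely many coordinates share a common right neighbourhood of constancy. *)
Lemma path_right_locally_constant w : right_locally_constant (path w).
Proof.
move=> t t0.
have : \forall s \near t^'+, forall i, X i s w = X i t w.
  apply: (@filter_forall _ _ (fun i s => X i s w = X i t w)) => i.
  have [H _] := flip_cadlag (XP.1 i) w; exact: H t0.
by apply: filterS => s Xs; congr f; apply/ffunP => i; rewrite !ffunE.
Qed.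

(** Exactly one pair of configurations is realized at the two times; the finite sum gives both
    measurability and the expectation. *)
Lemma change_indicator s t w :
  (path w s != path w t)%:R%:E =
  (\sum_x \sum_y if f x != f y then
    (\1_(\bigcap_i two_times s t x y i) w)%:E else 0)%E :> \bar R.
Proof.
pose x0 : {ffun 'I_m -> bool} := [ffun i => X i s w].
pose y0 : {ffun 'I_m -> bool} := [ffun i => X i t w].
have indE x y : \1_(\bigcap_i two_times s t x y i) w = ((x == x0) && (y == y0))%:R :> R.
  rewrite indicE; congr ((nat_of_bool _)%:R); apply/idP/idP.
    rewrite inE => H; apply/andP; split; apply/eqP/ffunP => i; rewrite ffunE.
      by have [] := H i I.
    by have [] := H i I.
  move=> /andP[/eqP -> /eqP ->]; rewrite inE => i _.
  by split => /=; rewrite ffunE.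
under eq_bigr do under eq_bigr do rewrite indE.
rewrite (bigD1 x0)//= [X in (_ + X)%E]big1 => [|x /negPf xx0]; last first.
  by apply: big1 => y _; rewrite xx0; case: ifP.
rewrite adde0 (bigD1 y0)//= !eqxx/= big1 => [|y /negPf yy0]; last first.
  by rewrite yy0 ?andbF; case: ifP.
by rewrite adde0; case: ifP.
Qed.

Lemma measurable_change s t : 0 <= s -> 0 <= t ->
  measurable_fun setT (fun w => ((path w s != path w t)%:R : R)%:E).
Proof.
move=> s0 t0; under eq_fun do rewrite change_indicator.
apply: emeasurable_sum => x; apply: emeasurable_sum => y; case: (f x != f y) => //.
by apply/measurable_EFinP; apply: measurable_indic; exact: measurable_two_times.
Qed.

(** Independence factors each joint event over coordinates; the Markov property and the Bernoulli
    law evaluate each factor, independently of [s]. *)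
Lemma integral_change (tr : 'I_m -> R -> bool -> bool -> R) s h :
  (forall i, markov_for P (X i) (tr i)) ->
  0 <= s -> 0 <= h ->
  (\int[P]_w (path w s != path w (s + h))%:R%:E = (change_prob p tr f h)%:E)%E.
Proof.
move=> mk s0 h0; have sh0 : 0 <= s + h by rewrite addr_ge0.
under eq_integral do rewrite change_indicator.
have mi x y : measurable_fun setT (fun w => if f x != f y then
    (\1_(\bigcap_i two_times s (s + h) x y i) w)%:E else 0%E : \bar R).
  case: (f x != f y) => //.
  by apply/measurable_EFinP; apply: measurable_indic; exact: measurable_two_times.
rewrite ge0_integral_sum//; first last.
- by move=> x w _; apply: sume_ge0 => y _; case: ifP; rewrite // lee_fin.
- by move=> x; apply: emeasurable_sum.
rewrite /change_prob -sumEFin; apply: eq_bigr => x _.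
rewrite ge0_integral_sum//; last by move=> y w _; case: ifP.
rewrite [in RHS]big_mkcond -sumEFin; apply: eq_bigr => y _.
case: ifP => _; last by rewrite integral0.
rewrite integral_indic//; last exact: measurable_two_times.
rewrite setIT; transitivity (\prod_(i < m) P (two_times s (s + h) x y i))%E.
  apply: XP.2 => i.
  (* Independence applies to events of each coordinate's sigma-algebra, which contains both one-time
     events and hence their intersection. *)
  have [|_ _ _ setI_closed_sigma] :=
    (@sigma_algebraP _ _ (process_sigma (X i) `[0, +oo[) _).1 (@smallest_sigma_algebra _ _ _).
    by move=> A _; exact: subsetT.
  apply: setI_closed_sigma.
    by apply: sub_sigma_algebra; exists s, (x i); rewrite /= in_itv/= s0.
  by apply: sub_sigma_algebra; exists (s + h), (y i); rewrite /= in_itv/= sh0.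
rewrite -prodEFin; apply: eq_bigr => i _.
rewrite (markov_two_times (mk i))// EFinM.
by rewrite (stationary_law _ (XP.1 i)).
Qed.

Let grid_sum n w : (grid_changes (path w) n)%:R%:E =
  (\sum_(k < n.+1) (path w (k%:R / n.+1%:R) != path w (k.+1%:R / n.+1%:R))%:R%:E)%E
  :> \bar R.
Proof.
rewrite /grid_changes sumEFin -natr_sum -sum1_card big_mkcond/=.
by congr (_%:R%:E); apply: eq_bigr => k _; rewrite inE; case: ifP.
Qed.

Lemma measurable_grid_changes n :
  measurable_fun setT (fun w => ((grid_changes (path w) n)%:R : R)%:E).
Proof.
under eq_fun do rewrite grid_sum.
by apply: emeasurable_sum => k; apply: measurable_change; rewrite divr_ge0.
Qed.

Lemma measurable_nb_changes : measurable_fun setT (nb_changes f X).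
Proof.
apply: emeasurable_fun_cvg measurable_grid_changes _ => w _.
exact: cvg_grid_changes (path_right_locally_constant w).
Qed.

Lemma nb_changes_ge0 w : (0 <= nb_changes f X w)%E.
Proof. exact: (@size_le_counting R _ _ [::]). Qed.

Lemma integral_nb_changes :
  (\int[P]_w nb_changes f X w = (\sum_(i < m) influence p f i)%:E)%E.
Proof.
have /choice[tr trP] : forall i, exists tr,
    is_markov_semigroup (flip_rate p) tr /\ markov_for P (X i) tr.
  by move=> i; have [tr] := flip_markov (XP.1 i); exists tr.
pose D n := (\int[P]_w (grid_changes (path w) n)%:R%:E)%E : \bar R.
(* All [n.+1] cells contribute equally, so the expectation is the difference quotient of
   [change_prob] at [h = 1 / n.+1]. *)
have DE n : D n = (change_prob p tr f n.+1%:R^-1 / n.+1%:R^-1)%:E.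
  rewrite /D; under eq_integral do rewrite grid_sum.
  rewrite ge0_integral_sum//; last first.
    by move=> k; apply: measurable_change; rewrite divr_ge0.
  under eq_bigr => k _.
    rewrite -[k.+1]addn1 natrD mulrDl mul1r.
    rewrite (integral_change (fun i => (trP i).2)) ?divr_ge0 ?invr_ge0//.
    over.
  by rewrite sumEFin sumr_const card_ord invrK mulr_natr.
have cD : D n @[n --> \oo] --> (\sum_(i < m) influence p f i)%:E.
  rewrite (_ : D = fun n => (change_prob p tr f n.+1%:R^-1 / n.+1%:R^-1)%:E); last exact/funext.
  apply: cvg_EFin; first by near=> n.
  move/cvg_at_rightP : (@cvg_change_prob _ _ p tr (fun i => (trP i).1) f).
  apply; split=> [n|]; first by rewrite invr_gt0.
  exact: cvg_harmonic.
apply/eqP; rewrite eq_le; apply/andP; split.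
  (* Fatou's lemma bounds the expectation of the limit by the limit of the [D n]. *)
  rewrite -(cvg_limn_einf_sup cD).1; apply: le_trans (fatou P measurableT _ _) => //.
    rewrite le_eqVlt; apply/orP; left; apply/eqP; apply: eq_integral => w _.
    by rewrite (cvg_limn_einf_sup (cvg_grid_changes (path_right_locally_constant w))).1.
  exact: measurable_grid_changes.
(* Conversely every [D n] is at most the expectation, since grid counts never exceed the number of
   change times. *)
rewrite -(cvg_lim _ cD)//; apply: lime_le; first by apply/cvg_ex; eexists; exact: cD.
near=> n; apply: ge0_le_integral => //.
- exact: measurable_grid_changes.
- exact: measurable_nb_changes.
- by move=> w _; exact: grid_changes_le (path_right_locally_constant w).
Unshelve. all: by end_near. Qed.

End dynamics.

Theorem proposition1p19 (R : realType) (m : nat -> nat)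
    (f : forall n, {ffun 'I_(m n) -> bool} -> bool)
    (p : nat -> R) (p01 : forall n, 0 <= p n <= 1)
    (d : nat -> measure_display) (T : forall n, measurableType (d n))
    (P : forall n, probability (T n) R)
    (X : forall n, 'I_(m n) -> R -> T n -> bool)
    (dynX : forall n, dynamics (P n) (p n) (X n)) :
  (forall n, (\int[P n]_w nb_changes (f n) (X n) w =
              (\sum_(i < m n) influence (p n) (f n) i)%:E)%E) /\
  ((ereal_sup (range (fun n =>
      (\sum_(i < m n) influence (p n) (f n) i)%:E)) < +oo)%E ->
   tame P f X).
Proof.
have EC n := integral_nb_changes (dynX n) (f n).
split => // supI e e0.
set I := fun n => _ in supI.
have IM n : (I n <= ereal_sup (range I))%E by apply: ereal_sup_ubound; exists n.
(* The supremum is finite: below [+oo] by assumption, and above [-oo] since it dominates the real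
   number [I 0]. *)
have supE : ereal_sup (range I) = (fine (ereal_sup (range I)))%:E.
  by rewrite fineK// fin_numE (lt_eqF supI) andbT -ltNye (lt_le_trans _ (IM 0%N))// ltNyr.
(* The quotient makes [K * e] at least the supremum; the maximum with [1] keeps [K] positive. *)
pose K := Num.max 1 (fine (ereal_sup (range I)) / e).
have K0 : 0 < K by rewrite lt_max ltr01.
exists K => n.
have mC := measurable_nb_changes (dynX n) (f n).
have mE : measurable [set w | (K%:E < `|nb_changes (f n) (X n) w|)%E].
  rewrite -[X in measurable X]setTI; apply: emeasurable_fun_o_infty => //.
  exact: measurableT_comp.
have := @le_integral_comp_abse _ _ _ (P n) setT measurableT _ K id
  (@measurable_id _ _ _) (fun r => id) (fun x y _ _ => id) mC K0.
rewrite setTI => markovC.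
rewrite -(@lee_pmul2l _ K%:E) ?lte_fin// -EFinM.
(* Markov's inequality bounds the event with [<=], which contains the strict one of [tight]. *)
apply: (@le_trans _ _ (K%:E * P n [set w | (K%:E <= `|nb_changes (f n) (X n) w|)%E])%E).
  rewrite lee_pmul2l// ?lte_fin//; apply: le_measure; rewrite ?inE//.
    rewrite -[X in measurable X]setTI; apply: emeasurable_fun_c_infty => //.
    exact: measurableT_comp.
  by move=> w; exact: ltW.
apply: le_trans markovC _.
under eq_integral do rewrite gee0_abs ?nb_changes_ge0//.
rewrite EC (le_trans (IM n))// supE lee_fin -ler_pdivrMr//.
by rewrite le_max lexx orbT.
Qed.
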